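(* The closure in $\mathrm{SO}(4)$ $$\mathbf{H}=\overline{\bigcup_{a\ge 3\ \mathrm{odd}}\mathbf{H}_a}$$ satisfies $$\mathbf{H}=\left\langle [1,\mathbf{j}],[\mathbf{j},1],[e^{\mathbf{i}\phi},1],[1,e^{\mathbf{i}\psi}]\ \middle|\ \phi,\psi\in S^1\right\rangle$$ and is a compact Lie group of dimension $2$.
   Context: Let $\mathbb{H}$ be the quaternions with standard basis $1,\mathbf{i},\mathbf{j},\mathbf{k}$, identified with $\mathbb{R}^4$ in the obvious way. For unit quaternions $l,r$ let $[l,r]\in\mathrm{SO}(4)$ be the linear map $x\mapsto l x\bar r$ of $\mathbb{H}$. Thus $[l,r]=[-l,-r]$ and $[l,r][l',r']=[ll',rr']$. Put $e_p=e^{\pi\mathbf{i}/p}$. For odd $a,b\ge 3$ with $\gcd(a,b)=1$ let $H_{a,b}=\langle[e_a,1],[1,e_b],[1,\mathbf{j}],[\mathbf{j},1]\rangle\subset\mathrm{SO}(4)$, and for odd $a\ge3$ let $\mathbf{H}_a$ be the closure in $\mathrm{SO}(4)$ of the union of all $H_{a,b}$ with $b\ge 3$ odd and $\gcd(a,b)=1$. Here $S^1=\mathbb{R}/2\pi\mathbb{Z}$ denotes the set of angles. *)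

(* Defs.v *)
From HB Require Import structures.
From mathcomp Require Import all_boot all_order all_algebra.
From mathcomp Require Import all_classical all_reals all_analysis.
From mathcomp Require Import ring.
Set Implicit Arguments.
Unset Strict Implicit.
Unset Printing Implicit Defensive.
Import Order.TTheory GRing.Theory Num.Theory.
Import numFieldNormedType.Exports.
Local Open Scope classical_set_scope.
Local Open Scope ring_scope.

Section Quaternions.
Variable R : realType.

(* The quaternion a + b i + c j + d k is the column vector (a, b, c, d), so
   that a linear map of the quaternions is a 4 x 4 matrix acting on the left. *)
Definition quat (a b c d : R) : 'cV[R]_4 := \col_i [:: a; b; c; d]`_i.

Definition qone : 'cV[R]_4 := quat 1 0 0 0.
Definition qj : 'cV[R]_4 := quat 0 0 1 0.

Definition qmul (p q : 'cV[R]_4) : 'cV[R]_4 :=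
  quat (p 0 0 * q 0 0 - p 1 0 * q 1 0 - p 2 0 * q 2 0 - p 3 0 * q 3 0)
       (p 0 0 * q 1 0 + p 1 0 * q 0 0 + p 2 0 * q 3 0 - p 3 0 * q 2 0)
       (p 0 0 * q 2 0 - p 1 0 * q 3 0 + p 2 0 * q 0 0 + p 3 0 * q 1 0)
       (p 0 0 * q 3 0 + p 1 0 * q 2 0 - p 2 0 * q 1 0 + p 3 0 * q 0 0).

Definition qconj (p : 'cV[R]_4) : 'cV[R]_4 :=
  quat (p 0 0) (- p 1 0) (- p 2 0) (- p 3 0).

(* e^{i t} *)
Definition qexpi (t : R) : 'cV[R]_4 := quat (cos t) (sin t) 0 0.

(* [l, r], the matrix of x |-> l x r^*, see qrotE *)
Definition qrot (l r : 'cV[R]_4) : 'M[R]_4 :=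
  \matrix_(i, j) qmul (qmul l (delta_mx j 0)) (qconj r) i 0.

Definition SO4 : set 'M[R]_4 := [set A | A^T *m A = 1%:M /\ \det A = 1].

End Quaternions.

Arguments qone {R}.
Arguments qj {R}.
Arguments SO4 {R}.

Section QuaternionFacts.
Variable R : realType.
Implicit Types l r x : 'cV[R]_4.

Lemma ord4P (P : 'I_4 -> Prop) : P 0 -> P 1 -> P 2 -> P 3 -> forall i, P i.
Proof.
move=> P0 P1 P2 P3 [[|[|[|[|//]]]] h].
- by rewrite (_ : Ordinal h = 0) //; exact: val_inj.
- by rewrite (_ : Ordinal h = 1) //; exact: val_inj.
- by rewrite (_ : Ordinal h = 2) //; exact: val_inj.
- by rewrite (_ : Ordinal h = 3) //; exact: val_inj.
Qed.

Lemma sum4 (V : nmodType) (F : 'I_4 -> V) : \sum_i F i = F 0 + F 1 + F 2 + F 3.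
Proof.
rewrite !big_ord_recl big_ord0 addr0 !addrA.
by congr (_ + _ + _ + _); congr F; exact: val_inj.
Qed.

Lemma quatE (a b c d : R) :
  (quat a b c d 0 0 = a) * (quat a b c d 1 0 = b) *
  (quat a b c d 2 0 = c) * (quat a b c d 3 0 = d).
Proof. by rewrite !mxE. Qed.

Lemma quat_eta x : x = quat (x 0 0) (x 1 0) (x 2 0) (x 3 0).
Proof. by apply/colP; elim/ord4P; rewrite quatE. Qed.

Lemma qmulE (a b c d a' b' c' d' : R) :
  qmul (quat a b c d) (quat a' b' c' d') =
  quat (a * a' - b * b' - c * c' - d * d') (a * b' + b * a' + c * d' - d * c')
       (a * c' - b * d' + c * a' + d * b') (a * d' + b * c' - c * b' + d * a').
Proof. by rewrite /qmul !quatE. Qed.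

Lemma qconjE (a b c d : R) : qconj (quat a b c d) = quat a (- b) (- c) (- d).
Proof. by rewrite /qconj !quatE. Qed.

Lemma qmulA : associative (@qmul R).
Proof.
move=> x y z; rewrite (quat_eta x) (quat_eta y) (quat_eta z) !qmulE.
by congr quat; ring.
Qed.

Lemma qconjM l r : qconj (qmul l r) = qmul (qconj r) (qconj l).
Proof.
rewrite (quat_eta l) (quat_eta r) !(qmulE, qconjE); congr quat; ring.
Qed.

Lemma qmulDr l x y : qmul l (x + y) = qmul l x + qmul l y.
Proof. by apply/colP; elim/ord4P; rewrite !(quatE, mxE) /=; ring. Qed.

Lemma qmulDl x y r : qmul (x + y) r = qmul x r + qmul y r.
Proof. by apply/colP; elim/ord4P; rewrite !(quatE, mxE) /=; ring. Qed.

Lemma qmulZr (a : R) l x : qmul l (a *: x) = a *: qmul l x.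
Proof. by apply/colP; elim/ord4P; rewrite !(quatE, mxE) /=; ring. Qed.

Lemma qmulZl (a : R) x r : qmul (a *: x) r = a *: qmul x r.
Proof. by apply/colP; elim/ord4P; rewrite !(quatE, mxE) /=; ring. Qed.

Lemma qmulNN l r : qmul (- l) (- r) = qmul l r.
Proof. by apply/colP; elim/ord4P; rewrite !(quatE, mxE) /=; ring. Qed.

Lemma col_delta x : x = \sum_j x j 0 *: delta_mx j 0.
Proof.
rewrite [LHS]matrix_sum_delta; apply: eq_bigr => j _.
by rewrite big_ord1.
Qed.

Lemma qrotE l r x : qrot l r *m x = qmul (qmul l x) (qconj r).
Proof.
apply/colP => i; rewrite mxE sum4 [in RHS](col_delta x) sum4.
rewrite !(qmulDr, qmulDl, qmulZr, qmulZl).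
by rewrite ![(_ + _ : 'cV_4) _ _]mxE ![(_ *: _ : 'cV_4) _ _]mxE
  ![qrot _ _ _ _]mxE ![_ * x _ _]mulrC.
Qed.

Lemma mulmx_inj (A B : 'M[R]_4) :
  (forall x : 'cV[R]_4, A *m x = B *m x) -> A = B.
Proof. by move=> AB; apply/trmx_inj/row_matrixP => i; rewrite -!tr_col !colE AB. Qed.

Lemma qrotM l r l' r' :
  qrot l r *m qrot l' r' = qrot (qmul l l') (qmul r r').
Proof.
by apply: mulmx_inj => x; rewrite -mulmxA !qrotE qconjM !qmulA.
Qed.

Lemma qrotNN l r : qrot (- l) (- r) = qrot l r.
Proof.
apply: mulmx_inj => x; rewrite !qrotE.
rewrite (_ : qconj (- r) = - qconj r); last first.
  by apply/colP; elim/ord4P; rewrite !(quatE, mxE).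
rewrite (_ : qmul (- l) x = - qmul l x) ?qmulNN//.
by rewrite -scaleN1r qmulZl scaleN1r.
Qed.

End QuaternionFacts.

Section GroupOn.
Variables (T : Type) (one : T) (mul : T -> T -> T) (inv : T -> T).

Definition group_on (G : set T) : Prop :=
  [/\ G one,
      forall x y, G x -> G y -> G (mul x y),
      forall x, G x -> G (inv x),
      forall x y z, G x -> G y -> G z -> mul x (mul y z) = mul (mul x y) z &
      forall x, G x ->
        [/\ mul one x = x, mul x one = x, mul (inv x) x = one
          & mul x (inv x) = one]].

End GroupOn.

Section LieGroup.
Variable R : realType.

(* C^k through iterated directional derivatives: on an open subset of a
   finite-dimensional space this is the usual notion. *)
Fixpoint Ck_on (V W : normedModType R) (k : nat) (D : set V) (f : V -> W) :
    Prop :=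
  match k with
  | 0 => forall x, D x -> {for x, continuous f}
  | k'.+1 => forall v,
      (forall x, D x -> derivable f x v) /\ Ck_on k' D ('D_v f)
  end.

(* Includes openness of the domain: for maps read in charts this is where
   continuity of the map between manifolds is required. *)
Definition smooth_on (V W : normedModType R) (D : set V) (f : V -> W) : Prop :=
  open D /\ forall k, Ck_on k D f.

Variable T : topologicalType.

Record chart (d : nat) := Chart {
  chart_dom : set T;
  chart_fun : T -> 'rV[R]_d;
  chart_inv : 'rV[R]_d -> T }.

Definition chart_im d (c : chart d) : set 'rV[R]_d :=
  chart_fun c @` chart_dom c.

(* c is a homeomorphism from a relatively open subset of M onto an open subset
   of R^d *)
Definition is_chart (M : set T) d (c : chart d) : Prop :=
  [/\ exists2 O : set T, open O & chart_dom c = M `&` O,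
      open (chart_im c),
      forall x, chart_dom c x -> chart_inv c (chart_fun c x) = x,
      {within chart_dom c, continuous (chart_fun c)} &
      {within chart_im c, continuous (chart_inv c)}].

Definition smooth_atlas (M : set T) d (A : set (chart d)) : Prop :=
  [/\ forall c, A c -> is_chart M c,
      forall x, M x -> exists2 c, A c & chart_dom c x &
      forall c c', A c -> A c' ->
        smooth_on [set u | chart_im c u /\ chart_dom c' (chart_inv c u)]
                  (chart_fun c' \o chart_inv c)].

(* G, with the subspace topology and the operations one, mul, inv, is a Lie
   group of dimension d. *)
Definition lie_group (d : nat) (one : T) (mul : T -> T -> T) (inv : T -> T)
    (G : set T) : Prop :=
  [/\ group_on one mul inv G,
      hausdorff_space (set_type G),
      @second_countable (set_type G) &
      exists A : set (chart d),
        [/\ smooth_atlas G A,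
            forall c1 c2 c, A c1 -> A c2 -> A c ->
              smooth_on
                [set u : 'rV[R]_d * 'rV[R]_d |
                  [/\ chart_im c1 u.1, chart_im c2 u.2 &
                      chart_dom c (mul (chart_inv c1 u.1) (chart_inv c2 u.2))]]
                (fun u => chart_fun c
                            (mul (chart_inv c1 u.1) (chart_inv c2 u.2))) &
            forall c1 c, A c1 -> A c ->
              smooth_on
                [set u | chart_im c1 u /\ chart_dom c (inv (chart_inv c1 u))]
                (fun u => chart_fun c (inv (chart_inv c1 u)))]].

End LieGroup.

Section TheGroups.
Variable R : realType.

(* Subgroup of SO(4) generated by S; meaningful for S included in SO4. *)
Definition gen_SO4 (S : set 'M[R]_4) : set 'M[R]_4 :=
  smallest
    [set G | G `<=` SO4 /\ group_on 1%:M mulmx invmx G] S.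

Definition closure_SO4 (S : set 'M[R]_4) : set 'M[R]_4 := SO4 `&` closure S.

(* e_p *)
Definition qe (p : nat) : 'cV[R]_4 := qexpi (pi / p%:R).

Definition Hab (a b : nat) : set 'M[R]_4 :=
  gen_SO4 [set qrot (qe a) qone; qrot qone (qe b);
                qrot qone qj; qrot qj qone].

Definition bHa (a : nat) : set 'M[R]_4 :=
  closure_SO4
    (\bigcup_(b in [set b | [&& (3 <= b)%N, odd b & coprime a b]]) Hab a b).

Definition bH : set 'M[R]_4 :=
  closure_SO4 (\bigcup_(a in [set a | (3 <= a)%N && odd a]) bHa a).

End TheGroups.

Arguments Hab R a b : clear implicits.
Arguments bHa R a : clear implicits.
Arguments bH R : clear implicits.

(* Main.v *)
Require Import Defs.
From HB Require Import structures.
From mathcomp Require Import all_boot all_order all_algebra.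
From mathcomp Require Import all_classical all_reals all_analysis.
From mathcomp Require Import ring lra zify.
Import numFieldNormedType.Exports.

(** Let Pin(2) be the group of the unit quaternions e^{it} and e^{it} j, and let
    K be the image of Pin(2) x Pin(2) under (l, r) |-> [l, r].  All three claims
    follow once both H and the group generated by the two circles and the two j's
    are identified with K.

    K is a subgroup of SO(4) ([pin2_rot_group]): Pin(2) is stable under product and
    conjugation, and the determinant is 1 because every element of Pin(2) is the
    square of a unit quaternion, so that [l, r] is the square of an orthogonal
    matrix.  K is compact ([pin2_rot_compact]), being a continuous image of circles,
    hence closed.  Every H_{a,b} is generated by elements of K, so closing up twice
    does not leave K.  Conversely H_{a,b} contains every [l, r] whose angles are
    natural multiples of pi/a and pi/b; taking the coprime pairs a = 2n+3, b = 2n+5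
    and letting n grow, such rotations converge to any given element of K
    ([bH_eq_pin2_rot]).  That the circles generate K is immediate from the
    factorization [l, r] = [l, 1][1, r] ([gen_SO4_circles]).

    For the Lie group structure, [torus p] = [e^{i p_0}, e^{i p_1}] is a
    homomorphism from R^2 to K. On the quaternions C + Cj it acts by the rotation of
    angle p_0 - p_1 of the first plane and the rotation of angle p_0 + p_1 of the
    second one, so p can be recovered by arcsines as long as both angles are smaller
    than pi/2 in absolute value; an element of K lies in the image of this box
    exactly when its first three diagonal entries are positive ([pos_diagP],
    [log_box_pos_diag]), an open condition. The charts are the translates p |-> g *m
    torus p. Conjugation by an element of K acts linearly on the angles
    ([torus_conj]), so that transition maps, product and inverse all become, in
    these charts, maps of the form u |-> log (torus (k + L u)) with L linear. Near
    each point such a map coincides with k + L u for a suitable choice of the angle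
    vector k, so it is locally affine, and locally affine maps are smooth
    ([locally_affine_Ck], [smooth_on_torus_chart]). *)

Set Implicit Arguments.
Unset Strict Implicit.
Unset Printing Implicit Defensive.
Import Order.TTheory GRing.Theory Num.Theory.
Local Open Scope classical_set_scope.
Local Open Scope ring_scope.

(** * The group Pin(2) of unit quaternions and its rotations *)

Section Algebra.
Context {R : realType}.
Implicit Types (l r x y : 'cV[R]_4) (a b t : R) (p q : 'rV[R]_2) (g h : 'M[R]_4).

(** The normalizer of the circle e^{it} in the unit quaternions.  Giving it by
    coordinates makes its stability under the operations a polynomial identity;
    [pin2P] recovers the angles. *)
Definition pin2 : set 'cV[R]_4 := [set l | exists a b,
  a ^+ 2 + b ^+ 2 = 1 /\ (l = quat a b 0 0 \/ l = quat 0 0 a b)].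

(** Pin(2) x Pin(2) modulo the pair (-1, -1), as a set of matrices. *)
Definition pin2_rot : set 'M[R]_4 :=
  [set g | exists2 l, pin2 l & exists2 r, pin2 r & g = qrot l r].

(** The angle is confined to one period so that the circles are images of a
    compact interval, and it is nonnegative so that [angle_approx] can use natural
    multiples of a small angle. *)
Lemma circle_angle a b : a ^+ 2 + b ^+ 2 = 1 ->
  exists2 t, 0 <= t <= pi *+ 2 & a = cos t /\ b = sin t.
Proof.
move=> ab1.
have a1 : -1 <= a <= 1.
  by rewrite -ler_norml -(@expr_le1 _ 2)// real_normK ?num_real//; nra.
have aI : a \in `[-1, 1] by rewrite in_itv.
have s2 : sin (acos a) = `|b|.
  by rewrite sin_acos// -sqrtr_sqr; congr Num.sqrt; lra.
have [b0|b0] := leP 0 b.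
  exists (acos a); last by rewrite acosK// s2 ger0_norm.
  by rewrite acos_ge0// mulr2n (le_trans (acos_lepi a1))// lerDl pi_ge0.
exists (pi *+ 2 - acos a).
  have := acos_lepi a1; have := acos_ge0 a1; have := @pi_ge0 R; rewrite mulr2n.
  by move=> *; apply/andP; split; lra.
rewrite addrC cosD2pi sinD2pi cosN sinN acosK// s2 ltr0_norm ?opprK//.
Qed.

Lemma pin2_qexpi t : pin2 (qexpi t).
Proof. by exists (cos t), (sin t); split; [exact: cos2Dsin2|left]. Qed.

Lemma pin2_qj : pin2 qj.
Proof. by exists 1, 0; split; [rewrite expr0n addr0 expr1n|right]. Qed.

Lemma pin2_1 : pin2 qone.
Proof. by exists 1, 0; split; [rewrite expr0n addr0 expr1n|left]. Qed.

Lemma qexpi_mulqj t : qmul (qexpi t) qj = quat 0 0 (cos t) (sin t).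
Proof. by rewrite qmulE; congr quat; ring. Qed.

Lemma pin2P l : pin2 l -> exists2 t, 0 <= t <= pi *+ 2 &
  l = qexpi t \/ l = qmul (qexpi t) qj.
Proof.
move=> [a [b [/circle_angle[t t2pi [-> ->]]] ll]]; exists t => //.
by rewrite qexpi_mulqj.
Qed.

Lemma pin2M l r : pin2 l -> pin2 r -> pin2 (qmul l r).
Proof.
move=> [a [b [ab ll]]] [c [d [cd rr]]].
have n1 : (a ^+ 2 + b ^+ 2) * (c ^+ 2 + d ^+ 2) = 1 by rewrite ab cd mulr1.
case: ll => ->; case: rr => ->; rewrite qmulE.
- exists (a * c - b * d), (a * d + b * c); split; first by rewrite -n1; ring.
  by left; congr quat; ring.
- exists (a * c - b * d), (a * d + b * c); split; first by rewrite -n1; ring.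
  by right; congr quat; ring.
- exists (a * c + b * d), (b * c - a * d); split; first by rewrite -n1; ring.
  by right; congr quat; ring.
- exists (- (a * c) - b * d), (a * d - b * c); split; first by rewrite -n1; ring.
  by left; congr quat; ring.
Qed.

Lemma pin2V l : pin2 l -> pin2 (qconj l).
Proof.
move=> [a [b [ab [->|->]]]]; rewrite qconjE.
  by exists a, (- b); split; [nra|left; congr quat; ring].
by exists (- a), (- b); split; [nra|right; congr quat; ring].
Qed.

Lemma pin2_conjl l : pin2 l -> qmul (qconj l) l = qone.
Proof.
by move=> [a [b [ab [->|->]]]]; rewrite qconjE qmulE; congr quat; nra.
Qed.

Lemma qmul1q l : qmul qone l = l.
Proof. by rewrite (quat_eta l) qmulE; congr quat; ring. Qed.

Lemma qmulq1 l : qmul l qone = l.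
Proof. by rewrite (quat_eta l) qmulE; congr quat; ring. Qed.

Lemma qexpi0 : qexpi 0 = qone :> 'cV[R]_4.
Proof. by rewrite /qexpi cos0 sin0. Qed.

Lemma qexpiD s t : qmul (qexpi s) (qexpi t) = qexpi (s + t) :> 'cV[R]_4.
Proof. by rewrite qmulE /qexpi cosD sinD; congr quat; ring. Qed.

Lemma qconj_qexpi t : qconj (qexpi t) = qexpi (- t) :> 'cV[R]_4.
Proof. by rewrite /qexpi qconjE cosN sinN oppr0. Qed.

(** e^{it} commutes with e^{is}, and j e^{it} = e^{-it} j: conjugation by an element
    of Pin(2) multiplies the angle by the sign e. *)
Lemma pin2_conj_qexpi l : pin2 l ->
  exists e : R, forall t, qmul (qexpi t) l = qmul l (qexpi (e * t)).
Proof.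
move=> [a [b [ab [->|->]]]]; [exists 1|exists (-1)] => t.
  by rewrite mul1r !qmulE; congr quat; ring.
by rewrite mulN1r /qexpi !qmulE cosN sinN; congr quat; ring.
Qed.

Lemma qrot11 : qrot qone qone = 1%:M :> 'M[R]_4.
Proof.
apply: mulmx_inj => x; rewrite qrotE qmul1q mul1mx.
by rewrite qconjE !oppr0 qmulq1.
Qed.

Lemma qconjK l : qconj (qconj l) = l.
Proof. by rewrite (quat_eta l) !qconjE !opprK. Qed.

Lemma qrot_split l r : qrot l r = qrot l qone *m qrot qone r.
Proof. by rewrite qrotM qmul1q qmulq1. Qed.

Definition qnorm2 (l : 'cV[R]_4) := l 0 0 ^+ 2 + l 1 0 ^+ 2 + l 2 0 ^+ 2 + l 3 0 ^+ 2.

Lemma qconj_mul l : qmul (qconj l) l = qnorm2 l *: qone.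
Proof.
rewrite {1 2}(quat_eta l) qconjE qmulE; apply/colP; elim/ord4P;
  by rewrite !mxE /= /qnorm2; ring.
Qed.

Lemma qmul_re_comm x y : qmul x y 0 0 = qmul y x 0 0.
Proof. by rewrite !quatE; ring. Qed.

Lemma qmul_re_conj x y : qmul (qconj x) y 0 0 = (x^T *m y) 0 0.
Proof. by rewrite !quatE !mxE sum4 !mxE /=; ring. Qed.

(** The inner product of x and y is the real part of x^* y.  For the images of x and
    y it is the real part of r x^* l^* l y r^*, where l^* l = 1 and, the real part
    being invariant under cyclic permutation, r^* r = 1 cancels as well. *)
Lemma qrot_orth l r : qnorm2 l = 1 -> qnorm2 r = 1 ->
  (qrot l r)^T *m qrot l r = 1%:M.
Proof.
move=> l1 r1.
have iso (x y : 'cV[R]_4) : (x^T *m ((qrot l r)^T *m qrot l r) *m y) 0 0 = (x^T *m y) 0 0.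
  rewrite -!mulmxA mulmxA -trmx_mul !qrotE. rewrite -!qmul_re_conj !qconjM qconjK.
  rewrite -qmulA qmul_re_comm -!qmulA qconj_mul r1 scale1r qmulq1.
  by rewrite (qmulA (qconj l)) qconj_mul l1 scale1r qmul1q.
move: (_^T *m _) iso => A iso; apply/matrixP => i j.
have := iso (delta_mx i 0) (delta_mx j 0).
by rewrite trmx_delta -!rowE -colE !mxE eqxx andbT.
Qed.

(** Spares the expansion of a 4 x 4 determinant: an orthogonal matrix has
    determinant 1 or -1, and passing to squares removes the sign. *)
Lemma orth_sqr_SO4 g : g^T *m g = 1%:M -> SO4 (g *m g).
Proof.
move=> gg; split; first by rewrite trmx_mul mulmxA -(mulmxA g^T) gg mulmx1.
by have := congr1 determinant gg; rewrite !det_mulmx det_tr det1.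
Qed.

(** Half the angle gives a root of e^{it}.  A unit imaginary quaternion q satisfies
    q^2 = -1, hence ((1 + q) / sqrt 2)^2 = q; this covers e^{it} j. *)
Lemma pin2_sqrt l : pin2 l -> exists2 m, qnorm2 m = 1 & qmul m m = l.
Proof.
move=> [a [b [ab [->|->]]]].
  have [t _ [-> ->]] := circle_angle ab.
  exists (qexpi (t / 2)); last by rewrite qexpiD -splitr.
  by rewrite /qnorm2 !quatE -[RHS](cos2Dsin2 (t / 2)); ring.
pose c : R := Num.sqrt (2^-1); have c2 : c ^+ 2 = 2^-1.
  by rewrite sqr_sqrtr// invr_ge0.
exists (quat c 0 (c * a) (c * b)).
  by rewrite /qnorm2 !quatE !exprMn c2; lra.
rewrite qmulE; congr quat; try by ring.
- transitivity (c ^+ 2 * (1 - (a ^+ 2 + b ^+ 2))); first by ring.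
  by rewrite ab subrr mulr0.
- by transitivity (2 * c ^+ 2 * a); [ring|rewrite c2 divff ?mul1r].
- by transitivity (2 * c ^+ 2 * b); [ring|rewrite c2 divff ?mul1r].
Qed.

Lemma qrot_SO4 l r : pin2 l -> pin2 r -> SO4 (qrot l r).
Proof.
move=> /pin2_sqrt[m m1 <-] /pin2_sqrt[n n1 <-]; rewrite -qrotM.
exact/orth_sqr_SO4/qrot_orth.
Qed.

Lemma SO4_unit g : SO4 g -> g \in unitmx.
Proof. by move=> [_ dg]; rewrite unitmxE dg unitr1. Qed.

Lemma invmx_qrot l r : pin2 l -> pin2 r ->
  invmx (qrot l r) = qrot (qconj l) (qconj r).
Proof.
move=> pl pr; have u := SO4_unit (qrot_SO4 pl pr).
apply: (can_inj (mulmxK u)); rewrite mulVmx// qrotM !pin2_conjl//.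
by rewrite qrot11.
Qed.

Lemma pin2_rotM g h : pin2_rot g -> pin2_rot h -> pin2_rot (g *m h).
Proof.
move=> [l pl [r pr ->]] [l' pl' [r' pr' ->]]; rewrite qrotM.
by exists (qmul l l'); [exact: pin2M|exists (qmul r r'); [exact: pin2M|]].
Qed.

Lemma pin2_rotV g : pin2_rot g -> pin2_rot (invmx g).
Proof.
move=> [l pl [r pr ->]]; rewrite invmx_qrot//.
by exists (qconj l); [exact: pin2V|exists (qconj r); [exact: pin2V|]].
Qed.

Lemma pin2_rot1 : pin2_rot 1%:M.
Proof.
by exists qone; [exact: pin2_1|exists qone; [exact: pin2_1|rewrite qrot11]].
Qed.

Lemma pin2_rot_SO4 : pin2_rot `<=` SO4.
Proof. by move=> _ [l pl [r pr ->]]; exact: qrot_SO4. Qed.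

Lemma pin2_rot_unit g : pin2_rot g -> g \in unitmx.
Proof. by move/pin2_rot_SO4/SO4_unit. Qed.

Lemma pin2_rot_group : group_on 1%:M mulmx invmx pin2_rot.
Proof.
split; [exact: pin2_rot1|exact: pin2_rotM|exact: pin2_rotV| |].
- by move=> *; rewrite mulmxA.
- by move=> g /pin2_rot_unit ug; rewrite mul1mx mulmx1 mulVmx// mulmxV.
Qed.

Lemma gen_SO4_sub (S : set 'M[R]_4) : S `<=` gen_SO4 S.
Proof. exact: sub_gen_smallest. Qed.

Lemma gen_SO4_1 (S : set 'M[R]_4) : gen_SO4 S 1%:M.
Proof. by move=> G [[_ [G1 _ _ _ _]] _]. Qed.

Lemma gen_SO4_M (S : set 'M[R]_4) g h :
  gen_SO4 S g -> gen_SO4 S h -> gen_SO4 S (g *m h).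
Proof.
move=> Sg Sh G [/[dup] -[_ [_ GM _ _ _]] CG SG].
by apply: GM; [exact: Sg|exact: Sh].
Qed.

Lemma gen_SO4_sub_pin2_rot (S : set 'M[R]_4) : S `<=` pin2_rot -> gen_SO4 S `<=` pin2_rot.
Proof.
move=> SP; apply: smallest_sub => //; split; first exact: pin2_rot_SO4.
exact: pin2_rot_group.
Qed.

Lemma gen_qexpi_mul (S : set 'M[R]_4) s t (k : nat) :
  gen_SO4 S (qrot (qexpi s) (qexpi t)) ->
  gen_SO4 S (qrot (qexpi (k%:R * s)) (qexpi (k%:R * t))).
Proof.
move=> Sst; elim: k => [|k IH].
  by rewrite !mul0r qexpi0 qrot11; exact: gen_SO4_1.
rewrite -natr1 !mulrDl !mul1r -!qexpiD -qrotM.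
exact: gen_SO4_M.
Qed.

Lemma gen_SO4_qrot (S : set 'M[R]_4) l r s t :
  gen_SO4 S (qrot qj qone) -> gen_SO4 S (qrot qone qj) ->
  gen_SO4 S (qrot (qexpi s) qone) -> gen_SO4 S (qrot qone (qexpi t)) ->
  l = qexpi s \/ l = qmul (qexpi s) qj -> r = qexpi t \/ r = qmul (qexpi t) qj ->
  gen_SO4 S (qrot l r).
Proof.
move=> Sj1 S1j Ss St ll rr; rewrite qrot_split; apply: gen_SO4_M.
  by case: ll => ->//; rewrite -(qmulq1 qone) -qrotM; exact: gen_SO4_M.
by case: rr => ->//; rewrite -(qmulq1 qone) -qrotM; exact: gen_SO4_M.
Qed.

End Algebra.

(** * Limits of matrices and quaternions, compact subspaces *)

Section SubtypeTopology.

Lemma set_type_hausdorff (T : topologicalType) (K : set T) :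
  hausdorff_space T -> hausdorff_space (set_type K).
Proof.
move=> hT x y clxy; apply: val_inj; apply: hT => U V Ux Vy.
have [z [Uz Vz]] := clxy _ _ (@initial_continuous _ _ set_val x U Ux)
  (@initial_continuous _ _ set_val y V Vy).
by exists (set_val z).
Qed.

Lemma set_type_compact (T : topologicalType) (K : set T) :
  compact K -> compact [set: set_type K].
Proof.
move=> cK F PF _.
have [|p [Kp clp]] := cK (fmap (@set_val _ K) F) _.
  by rewrite /fmap /=; apply: filterS filterT => x _; exact: set_valP.
exists (exist _ p (mem_set Kp)); split => // A B FA [_ [[W oW <-] Wp] WB].
have imA : fmap (@set_val _ K) F (set_val @` A).
  by rewrite /fmap/=; apply: filterS FA => x Ax; exists x.
have [_ [[x Ax <-] Wx]] := clp _ W imA (open_nbhs_nbhs (conj oW Wp)).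
by exists x; split => //; exact: WB.
Qed.

(** A compact pointed pseudometric space has a countable basis of balls;
    any point of K makes the subspace pointed. *)
Lemma set_type_second_countable (R : realType) (T : pseudoMetricType R) (K : set T) :
  K !=set0 -> compact K -> @second_countable (set_type K).
Proof.
move=> [p Kp] cK.
pose pt : set_type K := exist _ p (mem_set Kp).
pose S : pseudoPMetricType R := HB.pack (set_type K) (isPointed.Build (set_type K) pt).
exact: (@compact_second_countable R S (set_type_compact cK)).
Qed.

End SubtypeTopology.

Section Matrices.
Context {R : realType}.

Lemma cvg_mx (T : Type) (F : set_system T) (FF : Filter F) m n
    (f : T -> 'M[R]_(m, n)) (M : 'M[R]_(m, n)) :
  (forall i j, f x i j @[x --> F] --> M i j) -> f x @[x --> F] --> M.
Proof.
move=> fM A [P MP PA].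
apply: (@filterS _ F _ [set x | forall i j, P i j (f x i j)]).
  by move=> x Px; exact: PA.
by apply: filter_forall => i; apply: filter_forall => j; exact: fM.
Qed.

Lemma cvg_coord (T : Type) (F : set_system T) (FF : Filter F) m n
    (f : T -> 'M[R]_(m, n)) (M : 'M[R]_(m, n)) i j :
  f x @[x --> F] --> M -> f x i j @[x --> F] --> M i j.
Proof.
by move=> fM; apply: (cvg_comp f (fun N : 'M[R]_(m, n) => N i j) fM);
  exact: coord_continuous.
Qed.

Lemma cvg_mulmx (T : Type) (F : set_system T) (FF : Filter F) m n p
    (f : T -> 'M[R]_(m, n)) (g : T -> 'M[R]_(n, p)) (M : 'M[R]_(m, n)) (N : 'M[R]_(n, p)) :
  f x @[x --> F] --> M -> g x @[x --> F] --> N ->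
  f x *m g x @[x --> F] --> M *m N.
Proof.
move=> fM gN; apply: cvg_mx => i j; rewrite mxE.
under eq_cvg do rewrite mxE.
apply: cvg_big => [|k _]; first exact: add_continuous.
by apply: cvgM; exact: cvg_coord.
Qed.

Lemma cvg_quat (T : Type) (F : set_system T) (FF : Filter F)
    (f0 f1 f2 f3 : T -> R) (a b c d : R) :
  f0 x @[x --> F] --> a -> f1 x @[x --> F] --> b ->
  f2 x @[x --> F] --> c -> f3 x @[x --> F] --> d ->
  quat (f0 x) (f1 x) (f2 x) (f3 x) @[x --> F] --> quat a b c d.
Proof.
move=> *; apply: cvg_mx => + j; rewrite (ord1 j).
by elim/ord4P; rewrite quatE; under eq_cvg do rewrite quatE.
Qed.

Lemma cvg_qmul (T : Type) (F : set_system T) (FF : Filter F)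
    (f g : T -> 'cV[R]_4) (l r : 'cV[R]_4) :
  f x @[x --> F] --> l -> g x @[x --> F] --> r ->
  qmul (f x) (g x) @[x --> F] --> qmul l r.
Proof.
move=> fl gr.
have m i j : f x i 0 * g x j 0 @[x --> F] --> l i 0 * r j 0.
  by apply: cvgM; exact: cvg_coord.
apply: cvg_quat.
- exact: cvgB (cvgB (cvgB (m _ _) (m _ _)) (m _ _)) (m _ _).
- exact: cvgB (cvgD (cvgD (m _ _) (m _ _)) (m _ _)) (m _ _).
- exact: cvgD (cvgD (cvgB (m _ _) (m _ _)) (m _ _)) (m _ _).
- exact: cvgD (cvgB (cvgD (m _ _) (m _ _)) (m _ _)) (m _ _).
Qed.

Lemma cvg_qconj (T : Type) (F : set_system T) (FF : Filter F)
    (f : T -> 'cV[R]_4) (l : 'cV[R]_4) :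
  f x @[x --> F] --> l -> qconj (f x) @[x --> F] --> qconj l.
Proof.
move=> fl.
have c i : f x i 0 @[x --> F] --> l i 0 by exact: cvg_coord.
by apply: cvg_quat; [exact: c|exact: cvgN (c _)..].
Qed.

Lemma cvg_qrot (T : Type) (F : set_system T) (FF : Filter F)
    (f g : T -> 'cV[R]_4) (l r : 'cV[R]_4) :
  f x @[x --> F] --> l -> g x @[x --> F] --> r ->
  qrot (f x) (g x) @[x --> F] --> qrot l r.
Proof.
move=> fl gr; apply: cvg_mx => i j; rewrite mxE.
under eq_cvg do rewrite mxE.
apply: cvg_coord; apply: cvg_qmul; last exact: cvg_qconj.
by apply: cvg_qmul => //; exact: cvg_cst.
Qed.

Lemma cvg_qexpi (T : Type) (F : set_system T) (FF : Filter F) (f : T -> R) (t : R) :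
  f x @[x --> F] --> t -> qexpi (f x) @[x --> F] --> qexpi t.
Proof.
move=> ft; apply: cvg_quat; [| |exact: cvg_cst|exact: cvg_cst].
  by apply: (cvg_comp f cos ft); exact: continuous_cos.
by apply: (cvg_comp f sin ft); exact: continuous_sin.
Qed.

Lemma pin2_compact : compact (@pin2 R).
Proof.
have -> : @pin2 R = [set qexpi t | t in `[0, pi *+ 2]] `|`
    [set qmul (qexpi t) qj | t in `[0, pi *+ 2]].
  apply/seteqP; split=> [l /pin2P[t t2pi [->|->]]|_ [[t _ <-]|[t _ <-]]].
  - by left; exists t.
  - by right; exists t.
  - exact: pin2_qexpi.
  - by apply: pin2M; [exact: pin2_qexpi|exact: pin2_qj].
apply: compactU; apply: continuous_compact (segment_compact (b := _));
  apply: continuous_subspaceT => t.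
  by apply: cvg_qexpi; exact: cvg_id.
by apply: cvg_qmul; [apply: cvg_qexpi; exact: cvg_id|exact: cvg_cst].
Qed.

Lemma pin2_rot_compact : compact (@pin2_rot R).
Proof.
have -> : @pin2_rot R = [set qrot lr.1 lr.2 | lr in pin2 `*` pin2].
  apply/seteqP; split=> [_ [l pl [r pr ->]]|_ [[l r] [pl pr] <-]].
    by exists (l, r).
  by exists l => //; exists r.
apply: continuous_compact; last by apply: compact_setX; exact: pin2_compact.
apply: continuous_subspaceT => lr.
by apply: cvg_qrot; [exact: cvg_fst|exact: cvg_snd].
Qed.

Lemma pin2_rot_closed : closed (@pin2_rot R).
Proof. by apply: compact_closed pin2_rot_compact; exact: norm_hausdorff. Qed.

End Matrices.

(** * Identification of the closures *)

Section Closures.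
Context {R : realType}.

(** The multiplicity k is the integer part of t / (pi / a), so the error is at most
    pi / a <= pi / (n + 1). *)
Lemma angle_approx (t : R) (a : nat -> nat) : 0 <= t -> (forall n, (n < a n)%N) ->
  exists k : nat -> nat, (k n)%:R * (pi / (a n)%:R) @[n --> \oo] --> t.
Proof.
move=> t0 na.
have a0 n : 0 < (a n)%:R :> R by rewrite ltr0n (leq_trans _ (na n)).
have s0 n : 0 < pi / (a n)%:R :> R by rewrite divr_gt0 ?pi_gt0.
exists (fun n => Num.truncn (t / (pi / (a n)%:R))).
apply: (@squeeze_cvgr _ _ _ _ (fun n => t - pi * harmonic n) (fun=> t)); last exact: cvg_cst.
  apply: nearW => n.
  have td0 : 0 <= t / (pi / (a n)%:R) by rewrite divr_ge0// ltW.
  have /andP[kt tk] := truncn_itv td0.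
  rewrite -ler_pdivlMr// kt andbT lerBlDl.
  move: tk; rewrite ltr_pdivrMr// -natr1 mulrDl mul1r => /ltW/le_trans; apply.
  by rewrite addrC lerD2r ler_pM2l ?pi_gt0//= lef_pV2 ?posrE ?ltr0n ?ler_nat//
    (leq_trans _ (na n)).
have : t - pi * harmonic n @[n --> \oo] --> t - pi * 0.
  apply: cvgB; first exact: cvg_cst.
  by apply: cvgM; [exact: cvg_cst|exact: cvg_harmonic].
by rewrite mulr0 subr0.
Qed.

Lemma pin2_approx (l : 'cV[R]_4) (a : nat -> nat) :
  pin2 l -> (forall n, (n < a n)%N) ->
  exists2 l_ : nat -> 'cV[R]_4, l_ n @[n --> \oo] --> l &
    forall n, exists k : nat, l_ n = qexpi (k%:R * (pi / (a n)%:R)) \/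
                   l_ n = qmul (qexpi (k%:R * (pi / (a n)%:R))) qj.
Proof.
move=> /pin2P[t /andP[t0 _] ll] na.
have [k kt] := angle_approx t0 na.
case: ll => ->.
  exists (fun n => qexpi ((k n)%:R * (pi / (a n)%:R))); first exact: cvg_qexpi.
  by move=> n; exists (k n); left.
exists (fun n => qmul (qexpi ((k n)%:R * (pi / (a n)%:R))) qj).
  by apply: cvg_qmul; [exact: cvg_qexpi|exact: cvg_cst].
by move=> n; exists (k n); right.
Qed.

Lemma Hab_pin2_rot a b : Hab R a b `<=` pin2_rot.
Proof.
apply: gen_SO4_sub_pin2_rot => g [[[|]|]|] ->; rewrite /pin2_rot/=.
- by exists (qe R a); [exact: pin2_qexpi|exists qone; [exact: pin2_1|]].
- by exists qone; [exact: pin2_1|exists (qe R b); [exact: pin2_qexpi|]].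
- by exists qone; [exact: pin2_1|exists qj; [exact: pin2_qj|]].
- by exists qj; [exact: pin2_qj|exists qone; [exact: pin2_1|]].
Qed.

Lemma closure_SO4_sub_pin2_rot (S : set 'M[R]_4) :
  S `<=` pin2_rot -> closure_SO4 S `<=` pin2_rot.
Proof.
move=> SP g [_]; rewrite closureE; apply: smallest_sub => //.
exact: pin2_rot_closed.
Qed.

Lemma Hab_sub_bHa a b : (3 <= b)%N -> odd b -> coprime a b ->
  Hab R a b `<=` bHa R a.
Proof.
move=> b3 ob ab g Hg; split.
  exact/pin2_rot_SO4/(Hab_pin2_rot Hg).
by apply: subset_closure; exists b => //=; rewrite b3 ob.
Qed.

Lemma bH_eq_pin2_rot : bH R = pin2_rot.
Proof.
apply/seteqP; split.
  apply: closure_SO4_sub_pin2_rot => g [a _].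
  apply: closure_SO4_sub_pin2_rot => {}g [b _].
  exact: Hab_pin2_rot.
move=> _ [l pl [r pr ->]]; split; first exact: qrot_SO4.
(* a = 2n + 3 and b = 2n + 5 are odd, differ by 2, hence are coprime. *)
have na n : (n < (n.*2).+3)%N by lia.
have nb n : (n < (n.*2).+4.+1)%N by lia.
have [l_ ll lE] := pin2_approx pl na.
have [r_ rr rE] := pin2_approx pr nb.
apply: (@closed_cvg _ _ \oo _ (fun n => qrot (l_ n) (r_ n)) _ (@closed_closure _ _));
  last exact: cvg_qrot.
apply: nearW => n; apply: subset_closure.
exists (n.*2).+3; first by rewrite /= negbK odd_double.
apply: (@Hab_sub_bHa _ (n.*2).+4.+1) => //=; first by rewrite !negbK odd_double.
  rewrite -[(n.*2).+4.+1]addn2 /coprime gcdnDl -/(coprime _ 2).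
  by rewrite coprimen2 /= negbK odd_double.
have [k lk] := lE n; have [m rm] := rE n.
apply: (gen_SO4_qrot (s := _) (t := _) _ _ _ _ lk rm).
- by apply: gen_SO4_sub; right.
- by apply: gen_SO4_sub; left; right.
- have gk S s := @gen_qexpi_mul R S s 0 k; rewrite mulr0 qexpi0 in gk.
  by apply: gk; apply: gen_SO4_sub; left; left; left.
- have gm S t := @gen_qexpi_mul R S 0 t m; rewrite mulr0 qexpi0 in gm.
  by apply: gm; apply: gen_SO4_sub; left; left; right.
Qed.

Lemma gen_SO4_circles :
  gen_SO4 ([set qrot qone qj; qrot qj qone]
                 `|` [set qrot (qexpi phi) qone | phi in [set: R]]
                 `|` [set qrot qone (qexpi psi) | psi in [set: R]]) = pin2_rot.
Proof.
apply/seteqP; split.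
  apply: gen_SO4_sub_pin2_rot => g [[[|]->|]|].
  - by exists qone; [exact: pin2_1|exists qj; [exact: pin2_qj|]].
  - by exists qj; [exact: pin2_qj|exists qone; [exact: pin2_1|]].
  - by move=> [t _ <-]; exists (qexpi t); [exact: pin2_qexpi|exists qone; [exact: pin2_1|]].
  - by move=> [t _ <-]; exists qone; [exact: pin2_1|exists (qexpi t); [exact: pin2_qexpi|]].
move=> _ [l /pin2P[s _ ll] [r /pin2P[t _ rr] ->]].
apply: gen_SO4_qrot ll rr; apply: gen_SO4_sub.
- by left; left; right.
- by left; left; left.
- by left; right; exists s.
- by right; exists t.
Qed.

End Closures.

(** * Locally affine maps *)

Section LocallyAffine.
Context {R : realType} {V W : normedModType R}.
Implicit Types (D : set V) (f : V -> W) (L : V -> W).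

(** In the applications L is fixed, while k changes from point to point: it records
    the branch of the logarithm. *)
Definition locally_affine D f := forall x, D x -> exists k L,
  [/\ linear L, continuous L & \forall y \near x, f y = k + L y].

Lemma is_derive_affine L (k : W) x v : linear L -> continuous L ->
  is_derive x v (fun y => k + L y) (L v).
Proof.
move=> linL cL.
pose L' : {linear V -> W} := HB.pack L (GRing.isLinear.Build _ _ _ _ L linL).
have dL : differentiable L x by exact: (@linear_differentiable _ _ _ L').
have : is_derive x v L (L v).
  apply: DeriveDef; first exact: diff_derivable.
  by rewrite deriveE// (@diff_lin _ _ _ L').
move=> dLv; rewrite -[L v]add0r; exact: is_deriveD.
Qed.

(** Near each point the derivative of k + L y in the direction v is the constant
    L v, so the directional derivatives are locally affine again. *)
Lemma locally_affine_Ck D n f : locally_affine D f -> Ck_on n D f.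
Proof.
elim: n f => [|n IH] f aff /=.
  move=> x /[dup] Dx /aff[k [L [_ cL fE]]].
  rewrite /prop_for /continuous_at (nbhs_singleton fE).
  apply: cvg_trans (near_eq_cvg _) (cvgD (cvg_cst k) (cL x)).
  by apply: filterS fE => y ->.
move=> v; split=> [x /aff[k [L [linL cL fE]]]|].
  apply: (@near_eq_derivable _ _ _ (fun y => k + L y)).
    by apply: filterS fE => y ->.
  by have dL := is_derive_affine k x v linL cL; exact: ex_derive.
apply: IH => x /aff[k [L [linL cL fE]]].
exists (L v), (fun=> 0); split=> [a y z|y|].
- by rewrite scaler0 addr0.
- exact: cvg_cst.
- apply: filterS (nbhs_interior fE) => y fy; rewrite addr0.
  rewrite (near_eq_derive v fy).
  by have dL := is_derive_affine k y v linL cL; exact: derive_val.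
Qed.

End LocallyAffine.

(** * The maximal torus and its logarithm *)

Section Torus.
Context {R : realType}.
Implicit Types (p q : 'rV[R]_2) (g h M : 'M[R]_4).

Definition row2 (a b : R) : 'rV[R]_2 := \row_(j < 2) (if j == 0 then a else b).

Lemma row2E a b : (row2 a b 0 0 = a) * (row2 a b 0 1 = b).
Proof. by rewrite !mxE. Qed.

Lemma row2P p q : p 0 0 = q 0 0 -> p 0 1 = q 0 1 -> p = q.
Proof.
move=> p0 p1; apply/rowP => -[[|[|//]] i2].
  by rewrite (_ : Ordinal i2 = 0)//; exact: val_inj.
by rewrite (_ : Ordinal i2 = 1)//; exact: val_inj.
Qed.

Definition torus p : 'M[R]_4 := qrot (qexpi (p 0 0)) (qexpi (p 0 1)).

Lemma torus_pin2_rot p : pin2_rot (torus p).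
Proof.
by exists (qexpi (p 0 0)); [exact: pin2_qexpi|exists (qexpi (p 0 1)); [exact: pin2_qexpi|]].
Qed.

Lemma torusD p q : torus p *m torus q = torus (p + q).
Proof. by rewrite /torus qrotM !qexpiD !mxE. Qed.

Lemma torusV p : invmx (torus p) = torus (- p).
Proof. by rewrite invmx_qrot ?qconj_qexpi /torus ?mxE//; exact: pin2_qexpi. Qed.

Lemma torus_conj g : pin2_rot g -> exists L : 'rV[R]_2 -> 'rV[R]_2,
  [/\ linear L, continuous L & forall p, torus p *m g = g *m torus (L p)].
Proof.
move=> [l pl [r pr ->]].
have [d dE] := pin2_conj_qexpi pl; have [e eE] := pin2_conj_qexpi pr.
exists (fun p => row2 (d * p 0 0) (e * p 0 1)); split.
- move=> a p q; apply: row2P; rewrite !mxE /=; ring.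
- move=> p; apply: (@cvg_mx _ _ (nbhs p)) => i j; rewrite mxE; under eq_cvg do rewrite mxE.
  case: ifP => _; apply: cvgM; first [exact: cvg_cst|exact: coord_continuous].
- by move=> p; rewrite /torus !qrotM !row2E dE eE.
Qed.

(** On x + y i + (z + w i) j left multiplication by e^{is} adds s to the argument of
    both complex coordinates, whereas right multiplication by e^{-it} subtracts t
    from the first and, being moved across j, adds t to the second. *)
Lemma torus_act p (x y z w : R) : let u := p 0 0 - p 0 1 in let v := p 0 0 + p 0 1 in
  torus p *m quat x y z w =
  quat (cos u * x - sin u * y) (sin u * x + cos u * y)
       (cos v * z - sin v * w) (sin v * z + cos v * w).
Proof.
rewrite /= /torus qrotE qconj_qexpi /qexpi !qmulE cosN sinN !(cosD, sinD, cosN, sinN).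
by congr quat; ring.
Qed.

Lemma torus_eq p q :
  cos (p 0 0 - p 0 1) = cos (q 0 0 - q 0 1) -> sin (p 0 0 - p 0 1) = sin (q 0 0 - q 0 1) ->
  cos (p 0 0 + p 0 1) = cos (q 0 0 + q 0 1) -> sin (p 0 0 + p 0 1) = sin (q 0 0 + q 0 1) ->
  torus p = torus q.
Proof.
move=> cu su cv sv; apply: mulmx_inj => x.
by rewrite (quat_eta x) !torus_act /= cu su cv sv.
Qed.

(** By [torus_act] the entries (1, 0) and (3, 2) of [torus p] are the sines of
    p_0 - p_1 and p_0 + p_1. *)
Definition torus_log M : 'rV[R]_2 :=
  row2 ((asin (M 1 0) + asin (M 3 2)) / 2) ((asin (M 3 2) - asin (M 1 0)) / 2).

Definition log_box : set 'rV[R]_2 := [set p |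
  - (pi / 2) < p 0 0 - p 0 1 < pi / 2 /\ - (pi / 2) < p 0 0 + p 0 1 < pi / 2].

Definition pos_diag : set 'M[R]_4 := [set M | [/\ 0 < M 0 0, 0 < M 1 1 & 0 < M 2 2]].

Lemma entry_mul M i j : M i j = (M *m delta_mx j 0 : 'cV[R]_4) i 0.
Proof. by rewrite -colE mxE. Qed.

Lemma quat_delta : ((delta_mx 0 0 : 'cV[R]_4) = quat 1 0 0 0) *
  ((delta_mx 1 0 : 'cV[R]_4) = quat 0 1 0 0) *
  ((delta_mx 2 0 : 'cV[R]_4) = quat 0 0 1 0).
Proof. by do ![split]; apply/colP; elim/ord4P; rewrite !mxE. Qed.

Lemma torus_entries p : let u := p 0 0 - p 0 1 in let v := p 0 0 + p 0 1 in
  (torus p 0 0 = cos u) * (torus p 1 1 = cos u) * (torus p 2 2 = cos v) *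
  (torus p 1 0 = sin u) * (torus p 3 2 = sin v).
Proof.
rewrite /=; do ![split]; rewrite entry_mul quat_delta torus_act quatE; ring.
Qed.

(** The diagonal separates the four components of the group: if exactly one of l and
    r contains j, the two planes are swapped and the entry (0, 0) vanishes; if both
    do, the first plane undergoes a reflection and the entries (0, 0) and (1, 1) are
    opposite. *)
Lemma pos_diag_torus M : pin2_rot M -> pos_diag M -> exists p, M = torus p.
Proof.
move=> [l [a [b [ab ll]]] [r [c [d [cd rr]]] ->]] [].
have [s _ [sa sb]] := circle_angle ab; have [t _ [tc td]] := circle_angle cd.
rewrite !entry_mul !quat_delta !qrotE.
case: ll => ->; case: rr => ->; rewrite !qconjE !qmulE !quatE => M0 M1 M2.
- by exists (row2 s t); rewrite /torus !row2E /qexpi -sa -sb -tc -td.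
- by move: M0; rewrite [ltRHS](_ : _ = 0) ?ltxx//; ring.
- by move: M0; rewrite [ltRHS](_ : _ = 0) ?ltxx//; ring.
- by exfalso; lra.
Qed.

(** Reducing u modulo 2 pi by the arcsine is correct on the half circle where the
    cosine is positive. *)
Lemma asin_sin (u : R) : 0 < cos u ->
  [/\ cos (asin (sin u)) = cos u, sin (asin (sin u)) = sin u,
      - (pi / 2) < asin (sin u) < pi / 2 & -1 < sin u < 1].
Proof.
move=> cu; have := cos2Dsin2 u => cs.
have /andP[s1 s2] : -1 < sin u < 1 by apply/andP; split; nra.
split; last by rewrite s1.
- by rewrite cos_asin ?ltW// -cos2sin2 sqrtr_sqr gtr0_norm.
- by rewrite asinK// in_itv/= !ltW.
- by rewrite asin_ltpi2 ?asin_gtNpi2// ?(ltW s1) ?(ltW s2) ?s1 ?s2.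
Qed.

Lemma torus_logE M : (torus_log M 0 0 - torus_log M 0 1 = asin (M 1 0)) *
  (torus_log M 0 0 + torus_log M 0 1 = asin (M 3 2)).
Proof. by rewrite !row2E; split; field. Qed.

Lemma pos_diagP M : pin2_rot M -> pos_diag M ->
  [/\ torus (torus_log M) = M, log_box (torus_log M), -1 < M 1 0 < 1 & -1 < M 3 2 < 1].
Proof.
move=> pM dM; have [p Mp] := pos_diag_torus pM dM.
move: dM; rewrite Mp /pos_diag/= !torus_entries => -[u0 _ v0].
have [cu su bu s1] := asin_sin u0; have [cv sv bv s2] := asin_sin v0.
split => //; last by rewrite /log_box/= !torus_logE !torus_entries.
by apply: torus_eq; rewrite !torus_logE !torus_entries.
Qed.

Lemma log_box_pos_diag p : log_box p -> pos_diag (torus p).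
Proof.
by move=> [u v]; rewrite /pos_diag/= !torus_entries; split; exact: cos_gt0_pihalf.
Qed.

Lemma torus_logK p : log_box p -> torus_log (torus p) = p.
Proof.
move=> [/andP[u1 u2] /andP[v1 v2]]; rewrite /torus_log !torus_entries !sinK ?in_itv/= ?ltW//.
by apply: row2P; rewrite !row2E; field.
Qed.

Lemma open_log_box : open log_box.
Proof.
have c0 : continuous (fun p : 'rV[R]_2 => p 0 0) := @coord_continuous _ _ _ 0 0.
have c1 : continuous (fun p : 'rV[R]_2 => p 0 1) := @coord_continuous _ _ _ 0 1.
rewrite openE => p [/andP[u1 u2] /andP[v1 v2]]; rewrite /interior.
have cu : q 0 0 - q 0 1 @[q --> p] --> p 0 0 - p 0 1 by apply: cvgB; [exact: c0|exact: c1].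
have cv : q 0 0 + q 0 1 @[q --> p] --> p 0 0 + p 0 1 by apply: cvgD; [exact: c0|exact: c1].
near=> q; split; apply/andP; split; near: q.
- exact: (cvgr_gt _ cu).
- exact: (cvgr_lt _ cu).
- exact: (cvgr_gt _ cv).
- exact: (cvgr_lt _ cv).
Unshelve. all: by end_near. Qed.

Lemma open_pos_diag : open pos_diag.
Proof.
rewrite openE => M [M0 M1 M2]; rewrite /interior.
near=> N; split; near: N.
- exact: (cvgr_gt _ (@coord_continuous _ _ _ 0 0 M)).
- exact: (cvgr_gt _ (@coord_continuous _ _ _ 1 1 M)).
- exact: (cvgr_gt _ (@coord_continuous _ _ _ 2 2 M)).
Unshelve. all: by end_near. Qed.

Lemma torus_continuous : continuous torus.
Proof.
have c j : continuous (fun p : 'rV[R]_2 => p 0 j) := @coord_continuous _ _ _ 0 j.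
move=> p; apply: (@cvg_qrot _ _ (nbhs p)).
  exact: (@cvg_qexpi _ _ (nbhs p) _ _ _ (c 0 p)).
exact: (@cvg_qexpi _ _ (nbhs p) _ _ _ (c 1 p)).
Qed.

Lemma mulmx_continuous g : continuous (fun M : 'M[R]_4 => g *m M).
Proof. by move=> M; apply: (@cvg_mulmx _ _ (nbhs M)); [exact: cvg_cst|exact: cvg_id]. Qed.

Lemma torus_log_continuous M : -1 < M 1 0 < 1 -> -1 < M 3 2 < 1 ->
  {for M, continuous torus_log}.
Proof.
move=> M1 M3.
have a1 : asin (N 1 0) @[N --> M] --> asin (M 1 0).
  apply: (cvg_comp (fun N : 'M[R]_4 => N 1 0) _ (@coord_continuous _ _ _ 1 0 M)).
  exact: continuous_asin.
have a3 : asin (N 3 2) @[N --> M] --> asin (M 3 2).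
  apply: (cvg_comp (fun N : 'M[R]_4 => N 3 2) _ (@coord_continuous _ _ _ 3 2 M)).
  exact: continuous_asin.
apply: (@cvg_mx _ _ (nbhs M)) => i j; rewrite mxE; under eq_cvg do rewrite mxE.
case: ifP => _; apply: cvgM; try exact: cvg_cst; first exact: cvgD.
exact: cvgB.
Qed.

End Torus.

(** * The Lie group structure *)

Section Lie.
Context {R : realType}.
Implicit Types (p q : 'rV[R]_2) (g h M : 'M[R]_4).

Definition torus_chart g : chart R 'M[R]_4 2 := Chart
  (pin2_rot `&` [set M | pos_diag (invmx g *m M)])
  (fun M => torus_log (invmx g *m M)) (fun p => g *m torus p).

Lemma chart_im_torus_chart g : pin2_rot g -> chart_im (torus_chart g) = log_box.
Proof.
move=> pg; have ug := pin2_rot_unit pg; apply/seteqP; split=> [_ [M [pM dM] <-]|p bp].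
  by have [] := pos_diagP (pin2_rotM (pin2_rotV pg) pM) dM.
exists (g *m torus p); last by rewrite /= mulKmx// torus_logK.
split; first by apply: pin2_rotM => //; exact: torus_pin2_rot.
by rewrite /= mulKmx//; exact: log_box_pos_diag.
Qed.

Lemma torus_chart_is_chart g : pin2_rot g -> is_chart pin2_rot (torus_chart g).
Proof.
move=> pg; have ug := pin2_rot_unit pg; split.
- exists [set M | pos_diag (invmx g *m M)] => //.
  apply: open_comp open_pos_diag => M _; exact: mulmx_continuous.
- by rewrite chart_im_torus_chart//; exact: open_log_box.
- move=> M [pM dM] /=.
  have [-> _ _ _] := pos_diagP (pin2_rotM (pin2_rotV pg) pM) dM.
  by rewrite mulKVmx.
- apply: continuous_in_subspaceT => M /set_mem[pM dM].
  have [_ _ M1 M3] := pos_diagP (pin2_rotM (pin2_rotV pg) pM) dM.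
  apply: (@continuous_comp _ _ _ (fun M => invmx g *m M) torus_log).
    exact: mulmx_continuous.
  exact: torus_log_continuous.
- apply: continuous_subspaceT => p.
  apply: (@continuous_comp _ _ _ torus (fun M => g *m M)).
    exact: torus_continuous.
  exact: mulmx_continuous.
Qed.

(** The common form of the transition maps, of the product and of the inverse in the
    charts: h is a constant of the group and L a linear function of the
    coordinates. *)
Lemma smooth_on_torus_chart (V : normedModType R) (P : set V) (L : V -> 'rV[R]_2) g h
    (D : set V) (f : V -> 'rV[R]_2) :
  open P -> linear L -> continuous L -> pin2_rot g -> pin2_rot h ->
  (forall u, D u <-> P u /\ chart_dom (torus_chart g) (h *m torus (L u))) ->
  (forall u, f u = chart_fun (torus_chart g) (h *m torus (L u))) ->
  smooth_on D f.
Proof.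
move=> oP linL cL pg ph DE fE.
have pgh : pin2_rot (invmx g *m h) by apply: pin2_rotM => //; exact: pin2_rotV.
have phL u : pin2_rot (h *m torus (L u)) by apply: pin2_rotM => //; exact: torus_pin2_rot.
have pghL u : pin2_rot (invmx g *m (h *m torus (L u))).
  by apply: pin2_rotM => //; exact: pin2_rotV.
split.
  have -> : D = P `&` [set u | pos_diag (invmx g *m (h *m torus (L u)))].
    apply/seteqP; split=> u; first by move=> /DE[Pu []].
    by move=> [Pu du]; apply/DE.
  apply: openI => //; apply: open_comp open_pos_diag => u _.
  apply: (@continuous_comp _ _ _ L (fun p => invmx g *m (h *m torus p))); first exact: cL.
  apply: (@continuous_comp _ _ _ (fun p => h *m torus p) (fun M => invmx g *m M)); last first.
    exact: mulmx_continuous.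
  apply: (@continuous_comp _ _ _ torus (fun M => h *m M)); last exact: mulmx_continuous.
  exact: torus_continuous.
move=> n; apply: locally_affine_Ck => x /DE[_ [_ dx]].
have [tx bx _ _] := pos_diagP (pghL x) dx.
(* The point x shows that the constant factor g^-1 h lies in the torus; k is an
   angle vector for it, chosen so that k + L x lies in the range of the
   logarithm. *)
pose k := torus_log (invmx g *m (h *m torus (L x))) - L x.
have ghE : invmx g *m h = torus k.
  by rewrite /k -torusD tx -torusV -!mulmxA mulmxV ?mulmx1//;
    exact/pin2_rot_unit/torus_pin2_rot.
exists k, L; split => //.
have : \forall y \near x, log_box (k + L y).
  have kc : k + L y @[y --> x] --> k + L x by apply: cvgD; [exact: cvg_cst|exact: cL].
  apply: kc; apply: open_nbhs_nbhs; split; first exact: open_log_box.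
  by rewrite /k subrK.
by apply: filterS => y by_; rewrite fE /= mulmxA ghE torusD torus_logK.
Qed.

Lemma pin2_rot_lie_group : lie_group R (T := 'M[R]_4) 2 1%:M mulmx invmx pin2_rot.
Proof.
split; first exact: pin2_rot_group.
- by apply: set_type_hausdorff; exact: norm_hausdorff.
- by apply: set_type_second_countable; [exists 1%:M; exact: pin2_rot1|exact: pin2_rot_compact].
exists [set c | exists2 g, pin2_rot g & c = torus_chart g]; split.
- split.
  + by move=> _ [g pg ->]; exact: torus_chart_is_chart.
  + move=> g pg; exists (torus_chart g); first by exists g.
    split => //; rewrite /= mulVmx; last exact: pin2_rot_unit.
    by rewrite /pos_diag /= !mxE /= ltr01.
  + move=> _ _ [g pg ->] [g' pg' ->].
    apply: (@smooth_on_torus_chart _ (chart_im (torus_chart g)) id g' g) => //.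
    * by rewrite chart_im_torus_chart//; exact: open_log_box.
    * by move=> u; exact: cvg_id.
- move=> _ _ _ [g1 p1 ->] [g2 p2 ->] [g pg ->].
  have [L [linL cL LE]] := torus_conj p2.
  have prodE p q : g1 *m torus p *m (g2 *m torus q) = g1 *m g2 *m torus (L p + q).
    by rewrite -torusD !mulmxA -(mulmxA g1 (torus p)) LE !mulmxA.
  apply: (@smooth_on_torus_chart _
    (chart_im (torus_chart g1) `*` chart_im (torus_chart g2))
    (fun u => L u.1 + u.2) g (g1 *m g2)) => //.
  + rewrite !chart_im_torus_chart// (_ : log_box `*` log_box =
      fst @^-1` log_box `&` snd @^-1` log_box)//.
    by apply: openI; apply: open_comp open_log_box => u _; [exact: cvg_fst|exact: cvg_snd].
  + by move=> a [u u'] [v v'] /=; rewrite linL scalerDr addrACA.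
  + move=> u; apply: cvgD; last exact: cvg_snd.
    apply: (@continuous_comp _ _ _ fst L); [exact: cvg_fst|exact: cL].
  + exact: pin2_rotM.
  + by move=> u; rewrite -prodE; split=> [[]|[[]]].
  + by move=> u; rewrite -prodE.
- move=> _ _ [g1 p1 ->] [g pg ->].
  have [L [linL cL LE]] := torus_conj (pin2_rotV p1).
  have invE u : invmx (g1 *m torus u) = invmx g1 *m torus (L (- u)).
    have pu := pin2_rot_unit (pin2_rotM p1 (torus_pin2_rot u)).
    apply: (can_inj (mulmxK pu)); rewrite mulVmx// -LE -mulmxA mulKmx ?pin2_rot_unit//.
    by rewrite -torusV mulVmx//; exact/pin2_rot_unit/torus_pin2_rot.
  apply: (@smooth_on_torus_chart _ (chart_im (torus_chart g1))
    (fun u => L (- u)) g (invmx g1)) => //.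
  + by rewrite chart_im_torus_chart//; exact: open_log_box.
  + by move=> a u v; rewrite opprD -scalerN linL.
  + move=> u; apply: (@continuous_comp _ _ _ (fun v : 'rV[R]_2 => - v) L);
      [exact: oppr_continuous|exact: cL].
  + exact: pin2_rotV.
  + by move=> u; rewrite -invE.
  + by move=> u; rewrite /= invE.
Qed.

End Lie.

(* phi and psi range over R; the generators are 2 pi-periodic in them. *)
Theorem theorem1p4 (R : realType) :
  [/\ bH R =
        gen_SO4 ([set qrot qone qj; qrot qj qone]
                 `|` [set qrot (qexpi phi) qone | phi in [set: R]]
                 `|` [set qrot qone (qexpi psi) | psi in [set: R]]),
      compact (bH R) &
      lie_group R (T := 'M[R]_4) 2 1%:M mulmx invmx (bH R)].
Proof.
rewrite bH_eq_pin2_rot gen_SO4_circles.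
by split => //; [exact: pin2_rot_compact|exact: pin2_rot_lie_group].
Qed.
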